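(* Let $n\ge 1$ and let $q$ be the transpose top with random measure on $S_n$. For every $c\ge 0$ and every integer $t\ge n(\log n+c)$ we have $d_2(q^{(t)},u)\le \sqrt{2}\,e^{-c}$, and for every real $t\ge n(\log n+c)$ we have $d_2(h_{q,t},u)\le\sqrt{2}\,e^{-c}$.
   Context: For a probability measure $q$ on a finite group $G$, $q^{(t)}$ denotes the $t$-fold convolution power of $q$ (the law of $\xi_1\cdots\xi_t$ with $\xi_i$ i.i.d. of law $q$), $u\equiv 1/|G|$ is the uniform measure, and for a probability measure $p$ on $G$, $d_2(p,u)=\big(|G|\sum_{x\in G}|p(x)-u(x)|^2\big)^{1/2}$. The continuous time law is $h_{q,t}=e^{-t}\sum_{k\ge 0}\frac{t^k}{k!}q^{(k)}$, $t\ge 0$. The transpose top with random measure on $S_n$ is $q(\tau)=1/n$ if $\tau=(1,j)$ for some $1\le j\le n$ (with $(1,1)=e$ the identity), and $q(\tau)=0$ otherwise. *)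

(* Defs.v *)
From mathcomp Require Import all_boot all_fingroup.
From Stdlib Require Import Reals Factorial.
Set Implicit Arguments. Unset Strict Implicit. Unset Printing Implicit Defensive.

Definition sumR (T : finType) (f : T -> R) : R :=
  foldr (fun x acc => (f x + acc)%R) 0%R (enum T).

Definition conv (G : finGroupType) (p q : G -> R) : G -> R :=
  fun x => sumR (fun y : G => (p y * q ((y^-1) * x)%g)%R).

Definition delta_e (G : finGroupType) : G -> R :=
  fun x => if x == 1%g then 1%R else 0%R.

Fixpoint convpow (G : finGroupType) (q : G -> R) (t : nat) : G -> R :=
  match t with
  | O => @delta_e G
  | S k => conv (convpow q k) q
  end.

Definition unif (G : finGroupType) : G -> R := fun _ => (/ INR #|G|)%R.

Definition dist2 (G : finGroupType) (p : G -> R) : R :=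
  sqrt (INR #|G| * sumR (fun x : G => (Rabs (p x - @unif G x)) ^ 2))%R.

(* S_n with n = m+1, acting on 'I_(m+1); the point "1" is ord0. *)
Definition Sn (m : nat) := {perm 'I_m.+1}.

(* transpose top with random: q(tau) = 1/n if tau = (1,j), 1<=j<=n, (1,1)=e *)
Definition ttr (m : nat) : Sn m -> R :=
  fun tau => if [exists j : 'I_m.+1, tau == tperm ord0 j]
             then (/ INR m.+1)%R else 0%R.

Definition is_ctlaw (G : finGroupType) (q : G -> R) (t : R) (h : G -> R) : Prop :=
  forall x : G, infinite_sum
    (fun k => exp (- t) * (t ^ k / INR (fact k)) * convpow q k x)%R (h x).

(* Main.v *)
(* The walk is (1/n) B with B = \sum_j (1 j) acting on functions on S_n by
   right multiplication. Let K_m be the space of functions whose sums over all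
   cosets of Sym A, |A| = m, vanish. An induction on the symmetric group shows
   that every eigenvalue of B on K_m is an integer smaller than m. Since K_m
   is B-stable of codimension at most C(n,m) n!/m!, at most n^(2k)/k!
   eigenvalues of B are >= n - k. Twisting by the signature turns B into 2 -
   B, which gives the same bound for 2 - (eigenvalue). As B commutes with left
   translations, d_2^2 + 1 is the sum over the spectrum of the squared
   transforms of the eigenvalues, and each of these is at most exp(-2t/n)^k
   when the eigenvalue has absolute value n - k. *)
Require Import Defs.
From Stdlib Require Import Reals.
From mathcomp Require Import all_boot all_fingroup all_order all_algebra.
From mathcomp Require Import complex Rstruct ring lra zify.
Import Order.TTheory GRing.Theory Num.Theory.
Local Open Scope ring_scope.
Set Implicit Arguments. Unset Strict Implicit. Unset Printing Implicit Defensive.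

(** * Star sums of transpositions over symmetric groups of subsets *)

Section Star.
Variables (F : numFieldType) (T : finType) (o : T).
Implicit Types (f g : {perm T} -> F) (S A B : {set T}).

Lemma SymP S (s : {perm T}) : reflect (forall x, x \notin S -> s x = x) (s \in Sym S).
Proof.
rewrite inE; apply: (iffP subsetP) => [H x xS|H x].
  by apply/eqP; apply: contraNT xS => sx; apply: H; rewrite inE.
by rewrite inE; apply: contraR => /H ->.
Qed.

Lemma Sym_tperm S x y : x \in S -> y \in S -> tperm x y \in Sym S.
Proof.
move=> xS yS; apply/SymP => z zS; apply: tpermD.
  by apply: contraNneq zS => <-.
by apply: contraNneq zS => <-.
Qed.

Lemma Sym_closed S (s : {perm T}) x : s \in Sym S -> (s x \in S) = (x \in S).
Proof. by rewrite inE; apply: perm_closed. Qed.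

Lemma SymS A B : A \subset B -> Sym A \subset Sym B.
Proof.
move=> /subsetP AB; apply/subsetP => s /SymP sA; apply/SymP => x xB.
by apply: sA; apply: contra xB; apply: AB.
Qed.

Lemma Sym_commute A B (s t : {perm T}) :
  [disjoint A & B] -> s \in Sym A -> t \in Sym B -> (s * t = t * s)%g.
Proof.
move=> AB sA tB; apply/permP => x; rewrite !permM.
move/SymP: (sA) => sA'; move/SymP: (tB) => tB'.
have [xA|xA] := boolP (x \in A).
  have xB : x \notin B by rewrite (disjointFr AB).
  rewrite (tB' x xB) tB' //.
  by rewrite (disjointFr AB) // Sym_closed.
rewrite (sA' x xA) sA' //.
have [xB|xB] := boolP (x \in B); last by rewrite tB'.
by rewrite (disjointFl AB) // Sym_closed.
Qed.

(** A product applies its left factor first, so [t * s * t^-1] fixes [x] exactly when [s] fixes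
    [t x]. *)
Lemma Sym_conj A (s t : {perm T}) :
  (t * s * t^-1 \in Sym A)%g = (s \in Sym (t @: A)).
Proof.
have memt x : (t x \in t @: A) = (x \in A) by rewrite mem_imset //; apply: perm_inj.
apply/SymP/SymP => H x xA.
  have := H (t^-1 x)%g; rewrite -memt permKV !permM permKV => /(_ xA).
  by move/perm_inj.
by rewrite !permM H ?permK // memt.
Qed.

(** Each [s] in the larger group factors uniquely as [b * tperm o j], with [j] the image of [o]
    under [s] and [b] fixing [o]. *)
Lemma sum_SymU1 B f : o \notin B ->
  \sum_(s in Sym (o |: B)) f s =
  \sum_(j in o |: B) \sum_(b in Sym B) f (b * tperm o j)%g.
Proof.
move=> oB.
rewrite (partition_big (fun s : {perm T} => s o) (mem (o |: B))) /=; last first.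
  by move=> s sS; rewrite Sym_closed // !inE eqxx.
apply: eq_bigr => j jB.
rewrite (reindex_inj (mulIg (tperm o j))) /=; apply: eq_bigl => b.
apply/andP/idP => [[bS /eqP bo]|bB].
  have bo' : b o = o.
    by apply: (@perm_inj _ (tperm o j)); rewrite -permM bo tpermL.
  have bS' : b \in Sym (o |: B).
    rewrite -[b](mulgK (tperm o j)) groupM // groupV Sym_tperm //.
    by rewrite !inE eqxx.
  apply/SymP => x xB; have [->//|xo] := eqVneq x o.
  by move/SymP: bS'; apply; rewrite !inE negb_or xo.
have bU : b \in Sym (o |: B) by apply: subsetP bB; apply: SymS; apply: subsetUr.
have bo : b o = o by move/SymP: bB; apply.
rewrite groupM ?Sym_tperm // ?permM ?bo ?tpermL ?eqxx //.
by rewrite !inE eqxx.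
Qed.

(* Induction on [S]: a translate [g] of [f] averaged over a largest [A] with
   nonzero average either vanishes whenever the star is not hit by [A], which
   forces [mu = m - 1], or it restricts to [Sym (S :\: s @: A)], where the
   vanishing averages turn the eigenvalue [mu] into [mu + 1]. *)
Lemma star_eigen_coset S f (mu : F) m x : o \in S ->
  x \in Sym S -> f x != 0 ->
  (forall s, s \in Sym S -> \sum_(j in S) f (s * tperm o j)%g = mu * f s) ->
  (forall A s, A \subset S -> #|A| = m -> s \in Sym S ->
     \sum_(a in Sym A) f (s * a)%g = 0) ->
  exists2 z : int, mu = z%:~R & z < m.
Proof.
have [N] := ubnP #|S|; elim: N => // N IHN in S f mu m x *.
rewrite ltnS => SN oS xS fx H1 H2.
have small A (s : {perm T}) : (#|A| <= 1)%N -> s \in Sym A -> s = 1%g.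
  move=> A1 sA; apply/permP => y; rewrite perm1.
  have [yA|] := boolP (y \in A); last by move/SymP: sA; apply.
  by apply: (card_le1_eqP A1) => //; rewrite Sym_closed.
have vanish1 A : A \subset S -> (#|A| <= 1)%N -> #|A| = m -> False.
  move=> AS A1 Am; move/eqP: fx; apply.
  rewrite -(H2 A x AS Am xS) (big_pred1 1%g) ?mulg1 // => a; apply/idP/eqP.
    exact: small.
  by move=> ->.
(* Lowering [m] while all sums over sets of that size vanish ends at a set [A] of size [m] with a
   nonzero sum, whereas sets of size [m.+1] still give zero. Vanishing at size 0 or 1 would force
   [f x = 0]. *)
elim: m H2 vanish1 => [|m IHm] H2 vanish1.
  by case: (vanish1 set0); rewrite ?sub0set ?cards0.
have [m0|m_gt0] := posnP m.
  by case: (vanish1 [set o]); rewrite ?sub1set ?cards1 ?m0.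
have [H2'|] := boolP [forall A : {set T}, forall s : {perm T},
    [&& A \subset S, #|A| == m & s \in Sym S] ==>
    (\sum_(a in Sym A) f (s * a)%g == 0)].
  have [|A AS A1 Am|z -> zm] := IHm.
  - move=> A s AS Am sS; apply/eqP; move/forallP/(_ A)/forallP/(_ s): H2'.
    by rewrite AS Am eqxx sS.
  - move/eqP: fx; apply.
    have -> : f x = \sum_(a in Sym A) f (x * a)%g.
      rewrite (big_pred1 1%g) ?mulg1 // => a; apply/idP/eqP; first exact: small.
      by move=> ->.
    apply/eqP; move/forallP/(_ A)/forallP/(_ x): H2'.
    by rewrite AS Am eqxx xS.
  - by exists z => //; apply: lt_trans zm _; rewrite ltz_nat.
case/forallPn => A /forallPn [s1]; rewrite negb_imply => /andP[/and3P[AS /eqP Am s1S] nz].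
pose g (p : {perm T}) := \sum_(a in Sym A) f (s1 * a * p)%g.
have gA a p : a \in Sym A -> g (a * p)%g = g p.
  move=> aA; rewrite /g [RHS](reindex_inj (mulIg a)) /=.
  apply: eq_big => [b|b _]; first by rewrite groupMr.
  by rewrite !mulgA.
have AinS a : a \in Sym A -> a \in Sym S by apply/subsetP/SymS.
have g1 : g 1%g != 0.
  by rewrite (_ : g 1%g = \sum_(a in Sym A) f (s1 * a)%g) //; apply: eq_bigr => a _; rewrite mulg1.
have gH1 s : s \in Sym S -> \sum_(j in S) g (s * tperm o j)%g = mu * g s.
  move=> sS; rewrite /g mulr_sumr exchange_big /=; apply: eq_bigr => a aA.
  by rewrite -H1 ?groupM // ?AinS //; apply: eq_bigr => j _; rewrite !mulgA.
have gH2 (C : {set T}) s : C \subset S -> #|C| = m.+1 -> s \in Sym S ->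
     \sum_(a in Sym C) g (s * a)%g = 0.
  move=> CS Cm sS; rewrite /g exchange_big /= big1 // => a aA.
  by under eq_bigr do rewrite mulgA; apply: H2; rewrite ?groupM // AinS.
have [|] := boolP [exists s in Sym S, (s^-1%g o \notin A) && (g s != 0)]; last first.
  (* At the identity the eigenvalue equation keeps only the terms with [j] in [A], each equal to
     [g 1], so [mu] is the cardinal of [A]. *)
  move=> /exists_inPn H.
  have oA : o \in A.
    by have := H 1%g (group1 _); rewrite g1 andbT negbK invg1 perm1.
  have := gH1 1%g (group1 _).
  rewrite (bigID (mem A)) /= [X in _ + X]big1 ?addr0; last first.
    move=> j /andP[jS jA]; have := H _ (Sym_tperm oS jS).
    by rewrite tpermV tpermL jA mul1g /= negbK => /eqP.
  under eq_bigl => j.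
    have -> : (j \in S) && (j \in A) = (j \in A).
      by rewrite andb_idl //; apply/subsetP.
    over.
  rewrite /= (eq_bigr (fun=> g 1%g)); last first.
    by move=> j jA; rewrite mul1g -[tperm o j]mulg1 gA ?Sym_tperm.
  rewrite sumr_const Am -mulr_natl => /(mulIf g1) <-.
  by exists m; rewrite ?ltz_nat.
case/exists_inP => s0 s0S /andP[oA gs0].
pose B := s0 @: A.
have oB : o \notin B.
  by apply: contra oA => /imsetP[y yA ->]; rewrite permK.
have BS : B \subset S.
  by apply/subsetP => _ /imsetP[y /(subsetP AS) yS ->]; rewrite Sym_closed.
have Bm : #|B| = m by rewrite card_imset //; apply: perm_inj.
have S'S : Sym (S :\: B) \subset Sym S by apply: SymS; apply: subsetDl.
have S'in s : s \in Sym (S :\: B) -> s \in Sym S by apply/subsetP.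
have gB b s : b \in Sym B -> g (s0 * (b * s))%g = g (s0 * s)%g.
  move=> bB; rewrite -(gA (s0 * b * s0^-1)%g (s0 * s)%g) ?Sym_conj //.
  by rewrite !mulgA mulgKV.
have [||||||z zE zm] := IHN (S :\: B) (fun s => g (s0 * s)%g) (mu + 1) m.+1 1%g.
- apply: leq_trans SN; rewrite cardsD (setIidPr BS) Bm.
  by rewrite ltn_subrL m_gt0 (leq_trans m_gt0) // -Bm subset_leq_card.
- by rewrite !inE oB.
- exact: group1.
- by rewrite mulg1.
- move=> s sS'.
  have oU : o |: B \subset S by rewrite subUset sub1set oS.
  (* The zero sum over [Sym (o |: B)] splits into the star terms with [j] in [o |: B], so those with
     [j] in [B] add up to [- g (s0 * s)]. Dropping them from the star raises the eigenvalue by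
     one. *)
  have := gH2 (o |: B) (s0 * s)%g oU.
  rewrite cardsU1 oB Bm => /(_ erefl); rewrite groupM // ?S'in // => /(_ isT).
  rewrite sum_SymU1 // (eq_bigr (fun j => #|Sym B|%:R * g (s0 * s * tperm o j)%g)).
    rewrite -mulr_sumr => /eqP; rewrite mulf_eq0 pnatr_eq0.
    rewrite card_Sym eqn0Ngt fact_gt0 /=.
    rewrite big_setU1 //= tperm1 mulg1 addrC addr_eq0 => /eqP sB.
    rewrite mulrDl mul1r -gH1 ?groupM // ?S'in //.
    rewrite [in RHS](bigID (mem B)) /= addrAC.
    under [X in _ = X + _ + _]eq_bigl => j.
      have -> : (j \in S) && (j \in B) = (j \in B).
        by rewrite andb_idl //; apply/subsetP.
      over.
    rewrite /= sB addNr add0r; apply: eq_big => j; first by rewrite !inE andbC.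
    by rewrite mulgA.
  move=> j jB; rewrite (eq_bigr (fun=> g (s0 * s * tperm o j)%g)).
    by rewrite sumr_const mulr_natl.
  (* [b] commutes with [s], which fixes [B] pointwise, and is then absorbed by the left invariance
     [gB]. *)
  move=> b bB; rewrite -!mulgA (mulgA s b) -(Sym_commute _ bB sS') ?mulgA.
    by rewrite -!mulgA gB // !mulgA.
  by rewrite -setI_eq0 setIDA setDIl setDv set0I.
- move=> C s CS' Cm sS'; under eq_bigr do rewrite mulgA.
  apply: gH2; rewrite ?groupM // ?S'in //.
  by apply: subset_trans CS' (subsetDl _ _).
- exists (z - 1); first by rewrite intrD -zE rmorphN1 addrK.
  by apply: lt_trans zm; rewrite ltrBlDr ltrDl.
Qed.
End Star.

(** * Real symmetric matrices and eigenvectors in invariant subspaces *)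

(** The complex spectral theorem gives real eigenvalues. The minimal polynomial is unchanged by the
    field extension, so it is a product of distinct linear factors already over [R]. *)
Lemma symmetric_diagonalizable (R : rcfType) n (A : 'M[R]_n.+1) :
  A^T = A ->
  exists P : 'M[R]_n.+1, exists d : 'rV_n.+1,
    P \in unitmx /\ P *m A = diag_mx d *m P.
Proof.
move=> symA; pose Ac := map_mx (real_complex R) A.
have Areal : Ac \is a realmx.
  by apply/mxOverP => i j; rewrite mxE; apply/complex_realP; exists (A i j).
have Asym : Ac \is symmetricmx.
  apply/is_hermitianmxP; rewrite expr0 scale1r map_mx_id //.
  by rewrite /Ac map_trmx symA.
have Aherm := realsym_hermsym Asym Areal.
have Adiag := orthomx_spectralP (symmetric_normalmx Asym Areal).
have /mxOverP dreal := hermitian_spectral_diag_real Aherm.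
set Q := spectralmx Ac in Adiag; set e := spectral_diag Ac in Adiag dreal.
have minA : mxminpoly A = \prod_(r <- undup [seq complex.Re (e 0 i) | i <- enum 'I_n.+1]) ('X - r%:P).
  apply: (@map_poly_inj _ _ (real_complex R)).
  rewrite -mxminpoly_map -/Ac rmorph_prod /=.
  rewrite Adiag -conjVmx ?spectral_unit // mxminpoly_uconj ?unitmx_inv ?spectral_unit //.
  rewrite mxminpoly_diag.
  have -> : [seq e 0 i | i <- enum 'I_n.+1] =
     map (real_complex R) [seq complex.Re (e 0 i) | i <- enum 'I_n.+1].
    by elim: (enum _) => //= i l ->; rewrite RRe_real.
  rewrite undup_map_inj; last exact: complexI.
  rewrite big_map; apply: eq_bigr => r _.
  by rewrite rmorphB /= map_polyX map_polyC.
have [P uP /diagonalizable_forPex [d /(simmxP uP) Pd]] : diagonalizable A.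
  by apply/diagonalizableP; rewrite minA; eexists; [apply: undup_uniq|apply: dvdpp].
by exists P, d.
Qed.

(* [v *m diag_mx d - d_i *: v] has smaller support than [v] when [v_i != 0], and
   a [v] of minimal support is an eigenvector. *)
Lemma eigenvector_of_diag_closed (F : fieldType) n (d : 'rV[F]_n)
    (V : 'rV[F]_n -> Prop) (v : 'rV_n) :
  (forall (c : F) u, V u -> V (u *m diag_mx d - c *: u)) ->
  V v -> v != 0 ->
  exists w : 'rV_n, exists i, [/\ V w, w *m diag_mx d = d 0 i *: w,
    w 0 i != 0 & v 0 i != 0].
Proof.
move=> Vd; have [k] := ubnP #|[set i | v 0 i != 0]|.
elim: k v => // k IHk v; rewrite ltnS => vk Vv v0.
have /rV0Pn[i vi] := v0.
have [z|nz] := eqVneq (v *m diag_mx d - d 0 i *: v) 0.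
  by exists v, i; split=> //; apply/eqP; rewrite -subr_eq0 z.
have uE j : (v *m diag_mx d - d 0 i *: v) 0 j = (d 0 j - d 0 i) * v 0 j.
  by rewrite mul_mx_diag !mxE mulrBl [v 0 j * _]mulrC.
have [|w [j [Vw wd wj uj]]] := IHk _ _ (Vd (d 0 i) _ Vv) nz.
  apply: leq_trans vk; apply: proper_card; apply/properP; split.
    by apply/subsetP => j; rewrite !inE uE mulf_eq0 negb_or => /andP[].
  by exists i; rewrite !inE // uE subrr mul0r eqxx.
by exists w, j; split=> //; move: uj; rewrite uE mulf_eq0 negb_or => /andP[].
Qed.

Lemma sum_indicator (R : pzSemiRingType) (I : finType) (f : I -> R) i :
  \sum_j f j * (i == j)%:R = f i.
Proof.
rewrite (bigD1 i) //= eqxx mulr1 big1 ?addr0 // => j /negbTE.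
by rewrite eq_sym => ->; rewrite mulr0.
Qed.

(** * The star matrix and the count of its large eigenvalues *)

Section Matrix.
Variables (T : finType) (o : T) (N : nat).
Variables (e : 'I_N.+1 -> {perm T}) (r : {perm T} -> 'I_N.+1).
Hypotheses (eK : cancel e r) (rK : cancel r e).

Lemma sum_perm (V : nmodType) (f : 'I_N.+1 -> V) : \sum_i f i = \sum_s f (r s).
Proof. by apply: reindex; exists e => x _; rewrite ?eK ?rK. Qed.

Lemma card_enumeration : N.+1 = #|T|`!.
Proof.
rewrite -cardsT -card_Sym -[LHS]card_ord (bij_eq_card (Bijective eK rK)) -cardsT.
by congr #|pred_of_set _|; apply/setP => s; rewrite inE; apply/esym/SymP => x; rewrite inE.
Qed.

Lemma mul_tperm_eq (s t : {perm T}) k : (s * tperm o k == t)%g = (t * tperm o k == s)%g.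
Proof.
by apply/eqP/eqP => <-; rewrite -mulgA tperm2 mulg1.
Qed.

Section Field.
Variable F : numFieldType.

Definition starmx : 'M[F]_N.+1 :=
  \matrix_(i, j) \sum_k (e i * tperm o k == e j)%g%:R.

(** The space K_m, with functions on permutations read as row vectors through [r]. *)
Definition coset_sums_vanish m (u : 'rV[F]_N.+1) :=
  forall (A : {set T}) s, #|A| = m -> \sum_(a in Sym A) u 0 (r (s * a)%g) = 0.

Lemma starmx_sym : starmx^T = starmx.
Proof.
apply/matrixP => i j; rewrite !mxE; apply: eq_bigr => k _.
by rewrite mul_tperm_eq.
Qed.

Lemma mul_starmx (u : 'rV_N.+1) s :
  (u *m starmx) 0 (r s) = \sum_k u 0 (r (s * tperm o k)%g).
Proof.
rewrite mxE sum_perm.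
under eq_bigr do rewrite mxE mulr_sumr.
rewrite exchange_big /=; apply: eq_bigr => k _.
rewrite -(sum_indicator (fun t => u 0 (r t))); apply: eq_bigr => t _.
by rewrite !rK mul_tperm_eq.
Qed.

(** Right multiplication by [t] carries the coset [s * Sym A] onto [s * t * Sym (t @: A)], a coset
    for a set of the same size. *)
Lemma coset_sums_vanish_star m u :
  coset_sums_vanish m u -> coset_sums_vanish m (u *m starmx).
Proof.
move=> H A s Am; under eq_bigr do rewrite mul_starmx.
rewrite exchange_big big1 //= => k _; pose t := tperm o k.
rewrite -[RHS](H (t @: A) (s * t)%g); last by rewrite card_imset //; apply: perm_inj.
rewrite (reindex_inj (conjg_inj t^-1%g)) /=.
have cE (b : {perm T}) : (b ^ t^-1 = t * b * t^-1)%g by rewrite conjgE invgK mulgA.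
apply: eq_big => [b|b _]; rewrite cE ?Sym_conj //.
by rewrite -/t !mulgA mulgKV.
Qed.

Lemma coset_sums_vanish_lin m u v (c : F) :
  coset_sums_vanish m u -> coset_sums_vanish m v -> coset_sums_vanish m (u - c *: v).
Proof.
move=> Hu Hv A s Am; under eq_bigr do rewrite !mxE.
by rewrite big_split /= Hu // sumrN -mulr_sumr Hv // mulr0 subrr.
Qed.

Lemma starmx_eigen m (u : 'rV_N.+1) (mu : F) : u != 0 -> u *m starmx = mu *: u ->
  coset_sums_vanish m u -> exists2 z : int, mu = z%:~R & z < m%:Z.
Proof.
move=> u0 uB Hu.
have /rV0Pn[i ui] := u0.
have inT s : s \in Sym [set: T] by apply/SymP => x; rewrite inE.
apply: (@star_eigen_coset F T o [set: T] (fun s => u 0 (r s)) mu m (e i)) => //.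
- by rewrite eK.
- move=> s _; have := mul_starmx u s; rewrite uB mxE => ->.
  by apply: eq_bigl => j; rewrite inE.
- by move=> A s _ Am _; apply: Hu.
Qed.

(** For [m = #|T|.+1] the vanishing condition is vacuous, no subset being that large. *)
Lemma starmx_eigen_int (u : 'rV_N.+1) (mu : F) : u != 0 -> u *m starmx = mu *: u ->
  exists2 z : int, mu = z%:~R & z <= #|T|.
Proof.
move=> u0 uB; have [|z] := @starmx_eigen #|T|.+1 u mu u0 uB.
  by move=> A s Am; have := max_card (mem A); rewrite Am ltnn.
by exists z => //; rewrite -ltzD1 addrC -intS.
Qed.

End Field.

Section Counting.
Variable R : realFieldType.

(** The pairs index the linear conditions that cut out K_m; by Lagrange, each set of size [m] has
    [#|T|! / m!] cosets. *)
Lemma card_coset_pairs m :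
  (#|[set p : {set T} * {set {perm T}} |
     (#|p.1| == m) && (p.2 \in lcosets (Sym p.1) [set: {perm T}])]| * m`!)%N =
  ('C(#|T|, m) * #|T|`!)%N.
Proof.
rewrite -sum1_card.
rewrite (eq_bigl (fun p : {set T} * {set {perm T}} => (#|p.1| == m) &&
   (p.2 \in lcosets (Sym p.1) [set: {perm T}]))); last by move=> p; rewrite inE.
rewrite -(pair_big_dep (fun A : {set T} => #|A| == m)
  (fun A B => B \in lcosets (Sym A) [set: {perm T}]) (fun _ _ => 1%N)) /=.
rewrite big_distrl /= (eq_bigr (fun=> #|T|`!)); last first.
  move=> A /eqP Am; rewrite sum1_card card_lcosets mulnC -Am -card_Sym.
  rewrite Lagrange ?subsetT // -card_enumeration cardsT.
  by rewrite -(bij_eq_card (Bijective eK rK)) card_ord.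
by rewrite sum_nat_const -card_draws; congr (_ * _)%N; apply: eq_card => A; rewrite inE.
Qed.

(** If the eigenvalues that are at least [m] outnumbered the conditions, a nonzero combination of
    their eigenvectors would lie in K_m. By invariance K_m would then contain an eigenvector with
    such an eigenvalue, against [starmx_eigen]. *)
Lemma card_eigen_ge (P : 'M[R]_N.+1) (d : 'rV_N.+1) m :
  P \in unitmx -> P *m starmx R = diag_mx d *m P ->
  (#|[set i | (m%:R <= d 0 i)%R]| * m`! <= 'C(#|T|, m) * #|T|`!)%N.
Proof.
move=> uP PB; rewrite -card_coset_pairs leq_mul2r; apply/orP; right.
set I := [set i | _]; set X := [set p | _].
(* The columns of [L] are the indicators of the cosets. *)
pose L : 'M[R]_(N.+1, #|X|) := \matrix_(i, j) (e i \in (@enum_val _ (mem X) j).2)%:R.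
have VL u : u *m L = 0 -> coset_sums_vanish m u.
  move=> uL A s Am.
  have XA : (A, s *: Sym A)%g \in X.
    by rewrite inE /= Am eqxx /=; apply/lcosetsP; exists s; rewrite ?inE.
  have /rowP/(_ (enum_rank_in XA (A, s *: Sym A)%g)) := uL.
  rewrite !mxE sum_perm => uLA; rewrite -[RHS]uLA.
  rewrite [RHS](eq_bigr (fun t => if t \in (s *: Sym A)%g then u 0 (r t) else 0)).
    rewrite -big_mkcond /= [RHS](reindex_inj (mulgI s)) /=; apply: eq_bigl => a.
    by rewrite mem_lcoset mulKg.
  move=> t _; rewrite mxE enum_rankK_in //= rK.
  by case: ifP; rewrite ?mulr1 ?mulr0.
rewrite leqNgt; apply/negP => XI.
(* [W *m P] consists of the rows of [P] with index in [I]. They outnumber the columns of [L], so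
   [W *m P *m L] has a nonzero kernel. *)
pose W := rowsub (@enum_val _ (mem I)) (1%:M : 'M[R]_N.+1).
have [v [v0 vI vL]] : exists v : 'rV[R]_N.+1,
    [/\ v != 0, forall i, v 0 i != 0 -> i \in I & v *m P *m L = 0].
  have kn0 : kermx (W *m P *m L) != 0.
    by rewrite -mxrank_eq0 mxrank_ker subn_eq0 -ltnNge (leq_ltn_trans (rank_leq_col _)).
  pose w := nz_row (kermx (W *m P *m L)).
  have w0 : w != 0 by rewrite nz_row_eq0.
  have wE j : (w *m W) 0 (enum_val j) = w 0 j.
    rewrite mxE -[RHS](sum_indicator (fun k => w 0 k)); apply: eq_bigr => k _.
    by rewrite !mxE (inj_eq enum_val_inj) eq_sym.
  exists (w *m W); split.
  - apply: contraNneq w0 => wW; apply/eqP/rowP => j.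
    by rewrite -wE wW !mxE.
  - move=> i; apply: contraR => iI; rewrite mxE big1 // => k _.
    rewrite !mxE; case: eqP => [ki|]; last by rewrite mulr0.
    by move: iI; rewrite -ki enum_valP.
  - by apply/eqP; rewrite -!mulmxA [W *m _]mulmxA -sub_kermx nz_row_sub.
have [|w [i [Vw wd wi vi]]] := @eigenvector_of_diag_closed _ _ d
    (fun u => coset_sums_vanish m (u *m P)) v _ (VL _ vL) v0.
  move=> c u Vu; rewrite mulmxBl -scalemxAl -mulmxA -PB mulmxA.
  by apply: coset_sums_vanish_lin => //; apply: coset_sums_vanish_star.
have [||z dz zm] := @starmx_eigen R m (w *m P) (d 0 i) _ _ Vw.
- apply: contraNneq wi => wP.
  by rewrite -[w](mulmxK uP) wP mul0mx mxE.
- by rewrite -mulmxA PB mulmxA wd scalemxAl.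
have := vI i vi; rewrite inE dz leNgt => /negP; apply.
by rewrite -[m%:R]/(m%:Z%:~R) ltr_int.
Qed.
End Counting.
End Matrix.

(** * Functional calculus of a diagonalized matrix *)

Section SpectralFun.
Variables (F : fieldType) (n : nat) (P : 'M[F]_n) (d : 'rV[F]_n).
Hypothesis uP : P \in unitmx.
Implicit Types (g h : F -> F) (B X : 'M[F]_n).

Definition spectral_fun g : 'M[F]_n := invmx P *m diag_mx (map_mx g d) *m P.

(** An entry of [X] is zero unless its row and column carry equal eigenvalues, and these have equal
    images under [g]. *)
Lemma diag_comm_fun g X :
  X *m diag_mx d = diag_mx d *m X ->
  X *m diag_mx (map_mx g d) = diag_mx (map_mx g d) *m X.
Proof.
move=> /matrixP Xd; apply/matrixP => i j; have := Xd i j.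
rewrite !mul_mx_diag !mul_diag_mx !mxE [d 0 i * _]mulrC => /eqP.
rewrite -subr_eq0 -mulrBr mulf_eq0 subr_eq0 => /orP[/eqP ->|/eqP ->].
  by rewrite mul0r mulr0.
by rewrite mulrC.
Qed.

Lemma spectral_fun_comm g B X : P *m B = diag_mx d *m P ->
  X *m B = B *m X -> X *m spectral_fun g = spectral_fun g *m X.
Proof.
move=> PB XB; have BE : B = invmx P *m diag_mx d *m P.
  by rewrite -mulmxA -PB mulKmx.
have /diag_comm_fun H : P *m X *m invmx P *m diag_mx d = diag_mx d *m (P *m X *m invmx P).
  have -> : diag_mx d = P *m B *m invmx P by rewrite PB mulmxK.
  by rewrite !mulmxA !mulmxKV // -(mulmxA P X) XB mulmxA.
have := congr1 (fun Y => invmx P *m Y *m P) (H g).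
by rewrite /spectral_fun !mulmxA mulVmx // mul1mx mulmxKV // => ->.
Qed.

(** Symmetry of [B] makes [P *m P^T] commute with [diag_mx d], hence with its image under [g]; this
    takes the place of orthogonality of [P]. *)
Lemma spectral_fun_tr g B : P *m B = diag_mx d *m P -> B^T = B ->
  (spectral_fun g)^T = spectral_fun g.
Proof.
move=> PB symB.
have /diag_comm_fun H : P *m P^T *m diag_mx d = diag_mx d *m (P *m P^T).
  by rewrite -mulmxA -[diag_mx d in LHS]tr_diag_mx -trmx_mul -PB trmx_mul symB !mulmxA PB.
rewrite /spectral_fun !trmx_mul tr_diag_mx trmx_inv mulmxA.
apply: (canLR (mulmxK _)); first by rewrite unitmx_tr.
by rewrite -!mulmxA; apply: (canRL (mulKmx uP)); rewrite -H mulmxA.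
Qed.

Lemma spectral_funM g h :
  spectral_fun g *m spectral_fun h = spectral_fun (fun x => g x * h x).
Proof.
rewrite /spectral_fun !mulmxA mulmxK // -[X in X *m P]mulmxA mulmx_diag.
by congr (_ *m diag_mx _ *m _); apply/rowP => i; rewrite !mxE.
Qed.

Lemma trace_spectral_fun g : \tr (spectral_fun g) = \sum_i g (d 0 i).
Proof.
rewrite /spectral_fun mxtrace_mulC mulmxA mulmxV // mul1mx mxtrace_diag.
by apply: eq_bigr => i _; rewrite mxE.
Qed.

(** In the eigenbasis, [u] is supported on the coordinates with eigenvalue [a]. *)
Lemma mul_spectral_fun g B (u : 'rV_n) a : P *m B = diag_mx d *m P ->
  u *m B = a *: u -> u *m spectral_fun g = g a *: u.
Proof.
move=> PB uB; pose v := u *m invmx P.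
have vd : v *m diag_mx d = a *: v.
  by rewrite /v scalemxAl -uB -!mulmxA; congr (_ *m _); rewrite -[RHS](mulKmx uP) [P *m (_ *m _)]mulmxA PB mulmxK.
rewrite /spectral_fun !mulmxA -/v -[u in RHS](mulmxKV uP) -/v scalemxAl; congr (_ *m _); clearbody v.
apply/rowP => i; have /rowP/(_ i) := vd.
rewrite !mul_mx_diag !mxE mulrC => /eqP; rewrite -subr_eq0 -mulrBl mulf_eq0 subr_eq0.
by case/orP => /eqP ->; rewrite ?(mulr0, mul0r) // mulrC.
Qed.
End SpectralFun.

Lemma spectral_fun_exp (F : fieldType) n (P : 'M[F]_n.+1) d B k :
  P \in unitmx -> P *m B = diag_mx d *m P ->
  B ^+ k = spectral_fun P d (fun x => x ^+ k).
Proof.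
move=> uP PB; elim: k => [|k IHk].
  rewrite expr0 /spectral_fun (_ : diag_mx _ = 1%:M) ?mulmx1 ?mulVmx //.
  by apply/matrixP => i j; rewrite !mxE.
have BE : B = spectral_fun P d id.
  by rewrite /spectral_fun map_mx_id // -mulmxA -PB mulKmx.
rewrite exprSr IHk [in LHS]BE.
have -> : spectral_fun P d (fun x => x ^+ k) * spectral_fun P d id =
  spectral_fun P d (fun x => x ^+ k) *m spectral_fun P d id by [].
rewrite spectral_funM // /spectral_fun; congr (_ *m diag_mx _ *m _).
by apply/rowP => i; rewrite !mxE exprSr.
Qed.

Lemma spectral_funE (F : fieldType) n (P : 'M[F]_n) d (g : F -> F) i j :
  spectral_fun P d g i j = \sum_k invmx P i k * P k j * g (d 0 k).
Proof.
by rewrite /spectral_fun mxE; apply: eq_bigr => k _; rewrite mul_mx_diag !mxE mulrAC.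
Qed.

(** * Translation invariance, traces and the signature twist *)

Section StarSpectral.
Variables (T : finType) (o : T) (N : nat).
Variables (e : 'I_N.+1 -> {perm T}) (r : {perm T} -> 'I_N.+1).
Hypotheses (eK : cancel e r) (rK : cancel r e).
Variables (F : numFieldType) (P : 'M[F]_N.+1) (d : 'rV[F]_N.+1).
Hypotheses (uP : P \in unitmx) (PB : P *m starmx o e F = diag_mx d *m P).
Notation G := (spectral_fun P d).

(** Left translation by [z] commutes with the star matrix, hence with every function of it. *)
Lemma spectral_fun_diag g z : G g (r z) (r z) = G g (r 1%g) (r 1%g).
Proof.
pose L : 'M[F]_N.+1 := \matrix_(i, j) (z * e i == e j)%g%:R.
have LX (X : 'M[F]_N.+1) i j : (L *m X) i j = X (r (z * e i)%g) j.
  rewrite mxE -(sum_indicator (fun l => X l j)); apply: eq_bigr => l _.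
  by rewrite mxE mulrC -(inj_eq (can_inj eK)) rK.
have XL (X : 'M[F]_N.+1) i j : (X *m L) i j = X i (r (z^-1 * e j)%g).
  rewrite mxE -(sum_indicator (fun l => X i l)); apply: eq_bigr => l _.
  by rewrite mxE -(inj_eq (can_inj eK)) rK [in RHS]eq_sym -(can2_eq (mulKg _) (mulKVg _)).
have LB : L *m starmx o e F = starmx o e F *m L.
  apply/matrixP => i j; rewrite LX XL !mxE !rK; apply: eq_bigr => k _.
  by rewrite -mulgA -(can2_eq (mulKg _) (mulKVg _)).
have /matrixP/(_ (r 1%g) (r z)) := spectral_fun_comm uP g PB LB.
by rewrite LX XL !rK mulg1 mulVg.
Qed.

(** By symmetry the sum of squares is a diagonal entry of the matrix for [g ^ 2]; the diagonal being
    constant, it is the trace divided by [N.+1]. *)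
Lemma sum_spectral_fun_sq g :
  N.+1%:R * \sum_s G g (r 1%g) (r s) ^+ 2 = \sum_i g (d 0 i) ^+ 2.
Proof.
have -> : \sum_s G g (r 1%g) (r s) ^+ 2 = G (fun x => g x * g x) (r 1%g) (r 1%g).
  rewrite -spectral_funM // mxE (sum_perm eK rK); apply: eq_bigr => s _.
  rewrite expr2; congr (_ * _).
  by rewrite -[in LHS](spectral_fun_tr uP g PB (starmx_sym _ _ _)) mxE.
rewrite (eq_bigr (fun i => g (d 0 i) * g (d 0 i))); last by move=> i _; rewrite expr2.
rewrite -(trace_spectral_fun d uP (fun x => g x * g x)) /mxtrace (sum_perm eK rK).
rewrite (eq_bigr _ (fun s _ => spectral_fun_diag _ s)) sumr_const mulr_natl.
by rewrite -(bij_eq_card (Bijective eK rK)) card_ord.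
Qed.

(** The constant vector is an eigenvector with eigenvalue [#|T|], and by symmetry row sums are
    column sums. *)
Lemma sum_spectral_fun g : g #|T|%:R = 1 -> \sum_s G g (r 1%g) (r s) = 1.
Proof.
move=> g1; have oneB : const_mx 1 *m starmx o e F = #|T|%:R *: const_mx 1 :> 'rV_N.+1.
  apply/rowP => j; rewrite -[j]eK (mul_starmx _ eK rK) !mxE.
  by under eq_bigr do rewrite mxE; rewrite sumr_const mulr1.
have /rowP/(_ (r 1%g)) := mul_spectral_fun uP g PB oneB.
rewrite g1 scale1r !mxE (sum_perm eK rK) => H; rewrite -[RHS]H; apply: eq_bigr => s _.
by rewrite [const_mx _ _ _]mxE mul1r -[in LHS](spectral_fun_tr uP g PB (starmx_sym _ _ _)) mxE.
Qed.

(** Conjugation by the signature negates the transpositions in B and keeps the identity term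
    [k = o], so it turns B into 2 - B. *)
Lemma sign_twist : exists2 P' : 'M[F]_N.+1, P' \in unitmx &
  P' *m starmx o e F = diag_mx (\row_i (2 - d 0 i)) *m P'.
Proof.
pose S : 'M[F]_N.+1 := diag_mx (\row_i (-1) ^+ odd_perm (e i)).
have SS : S *m S = 1%:M.
  rewrite mulmx_diag; apply/matrixP => i j; rewrite !mxE.
  by rewrite -expr2 sqrr_sign.
have SB : S *m starmx o e F = (2%:M - starmx o e F) *m S.
  apply/matrixP => i j; rewrite mul_diag_mx mul_mx_diag !mxE.
  (* The scalar 2 is charged to the term [k = o]; the identity can then be checked term by term. *)
  have -> : 2 *+ (i == j) = \sum_k (if k == o then 2 else 0) * (e i * tperm o k == e j)%g%:R :> F.
    rewrite (bigD1 o) //= eqxx tperm1 mulg1 (inj_eq (can_inj eK)) mulr_natr.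
    by rewrite big1 ?addr0 // => k /negbTE ->; rewrite mul0r.
  rewrite -sumrB mulr_sumr mulr_suml; apply: eq_bigr => k _.
  case: eqP => [<-|_]; last by rewrite !mulr0 subrr mul0r.
  rewrite odd_permM odd_tperm eq_sym signr_addb !mulr1; case: eqP => _ /=.
    by rewrite expr0 mulr1 -[2]/(1 + 1) addrK mul1r.
  by rewrite sub0r expr1 mulN1r mulrN1 opprK.
exists (P *m S); first by rewrite unitmx_mul uP; case/mulmx1_unit: SS.
rewrite -mulmxA SB mulmxA mulmxBr PB [RHS]mulmxA; congr (_ *m S).
apply/matrixP => i j; rewrite mul_mx_scalar !mul_diag_mx !mxE.
by rewrite mulrBl.
Qed.

End StarSpectral.

(** * Level counts and the bound on the spectral sum *)

Lemma ffact_leq_exp n k : (n ^_ k <= n ^ k)%N.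
Proof.
rewrite ffact_prod -[in leqRHS](card_ord k) -prod_nat_const.
by apply: leq_prod => i _; apply: leq_subr.
Qed.

(** With [k = n - m], dividing by [m!] leaves [c <= 'C(n, k) * n ^_ k], and ['C(n, k) * k!] is again
    [n ^_ k]. *)
Lemma card_level_bound n m c : (m <= n)%N -> (c * m`! <= 'C(n, m) * n`!)%N ->
  (c * (n - m)`! <= n ^ (n - m) * n ^ (n - m))%N.
Proof.
move=> mn; rewrite -bin_sub //; set k := (n - m)%N.
have kn : (k <= n)%N by apply: leq_subr.
rewrite -(ffact_fact kn) (_ : (n - k = m)%N); last by rewrite subKn.
rewrite mulnA leq_pmul2r ?fact_gt0 // => ck.
apply: (@leq_trans ('C(n, k) * n ^_ k * k`!)); first by rewrite leq_mul2r ck orbT.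
by rewrite mulnAC bin_ffact leq_mul ?ffact_leq_exp.
Qed.

Lemma sum_sq_centered (F : numFieldType) (I : finType) (p : I -> F) :
  (0 < #|I|)%N -> \sum_i p i = 1 ->
  #|I|%:R * \sum_i (p i - #|I|%:R^-1) ^+ 2 = #|I|%:R * \sum_i p i ^+ 2 - 1.
Proof.
move=> I0 p1; have nz : #|I|%:R != 0 :> F by rewrite pnatr_eq0 -lt0n.
rewrite (eq_bigr (fun i => p i ^+ 2 - (2 / #|I|%:R) * p i + (#|I|%:R ^- 2))); last first.
  by move=> s _; field.
rewrite !big_split /= sumrN -mulr_sumr p1 sumr_const -mulr_natl.
by field.
Qed.

Section SumBound.
Variable R : realFieldType.

Lemma sum_inv_fact n : \sum_(k < n) (k`!%:R)^-1 <= 11 / 4 :> R.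
Proof.
(* The slack carries the induction because [3 / (k + 3) <= 1]; at [k = 0] there is equality. *)
have H k : \sum_(j < k.+3) (j`!%:R)^-1 <= 11 / 4 - (2 * k.+2`!%:R)^-1 :> R.
  elim: k => [|k IHk].
    by rewrite !big_ord_recr big_ord0 /= !factS fact0; lra.
  rewrite big_ord_recr /=; apply: le_trans (lerD IHk (lexx _)) _.
  rewrite [k.+3`!]factS natrM.
  have a0 : 0 < (k.+2`!%:R : R)^-1 by rewrite invr_gt0 ltr0n fact_gt0.
  have b0 : (k.+3%:R : R)^-1 <= 1 / 3.
    by rewrite div1r lef_pV2 ?posrE ?ltr0n // ler_nat.
  have := ler_wpM2r (ltW a0) b0; rewrite !invfM.
  move: (k.+3%:R^-1 * _) => ba; lra.
case: n => [|[|[|n]]]; try by rewrite ?big_ord_recr big_ord0 /= ?factS ?fact0; lra.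
apply: le_trans (H n) _; rewrite lerBlDr lerDl invr_ge0 mulr_ge0 //.
Qed.

Lemma sum_exp_fact_le n (E : R) : 0 <= E <= 1 ->
  \sum_(k < n) E ^+ k / k`!%:R <= 11 / 4.
Proof.
move=> /andP[E0 E1]; apply: le_trans (sum_inv_fact n); apply: ler_sum => k _.
by rewrite ler_piMl ?invr_ge0 // exprn_ile1.
Qed.

(** For positive [k], [E ^ k <= E]; and 7/4 is 11/4 less the term [k = 0]. *)
Lemma sum_exp_fact_tail n (E : R) : 0 <= E <= 1 ->
  \sum_(k < n) E ^+ k / k`!%:R <= 1 + 7 / 4 * E.
Proof.
move=> /andP[E0 E1]; case: n => [|n]; first by rewrite big_ord0; lra.
have := sum_inv_fact n.+1; rewrite !big_ord_recl /= expr0 fact0 divr1 invr1 => H.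
rewrite lerD2l; apply: (@le_trans _ _ (\sum_(i < n) E * ((bump 0 i)`!%:R)^-1)).
  apply: ler_sum => k _; apply: ler_wpM2r; first by rewrite invr_ge0.
  by rewrite exprS ler_piMr // exprn_ile1.
rewrite -mulr_sumr mulrC; apply: ler_wpM2r => //; lra.
Qed.

(** Here [th] lists the eigenvalues of B and [f] their squared transforms; [q] stands for exp(-2t/n)
    and [E] for exp(-2c). *)
Variables (I : finType) (n : nat) (th f : I -> R) (q E : R).
Hypotheses (q_ge0 : 0 <= q) (E01 : 0 <= E <= 1) (n_gt0 : (0 < n)%N)
  (nqE : n%:R ^+ 2 * q <= E).
Hypothesis th_int : forall i, exists2 z : int, th i = z%:~R & z <= n.
Hypothesis th'_int : forall i, exists2 z : int, 2 - th i = z%:~R & z <= n.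
Hypothesis card_th : forall m,
  (#|[set i | (m%:R <= th i)%R]| * m`! <= 'C(n, m) * n`!)%N.
Hypothesis card_th' : forall m,
  (#|[set i | (m%:R <= 2 - th i)%R]| * m`! <= 'C(n, m) * n`!)%N.
Hypothesis f_le : forall i k, (k <= n)%N -> `|th i| = (n - k)%:R -> f i <= q ^+ k.

(** At most [n ^ (2k) / k!] indices have value [n - k] or more, and [n ^ (2k) * q ^ k <= E ^ k]. *)
Lemma level_sum_le (t : I -> R) k : (k <= n)%N ->
  (forall m, (#|[set i | (m%:R <= t i)%R]| * m`! <= 'C(n, m) * n`!)%N) ->
  \sum_i (t i == (n - k)%:R)%:R * q ^+ k <= E ^+ k / k`!%:R.
Proof.
move=> kn ct; rewrite -mulr_suml.
have := card_level_bound (leq_subr k n) (ct (n - k)%N).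
rewrite subKn // -(ler_nat R) !natrM !natrX => H.
rewrite ler_pdivlMr ?ltr0n ?fact_gt0 // mulrAC.
apply: (@le_trans _ _ ((n%:R ^+ k * n%:R ^+ k) * q ^+ k)).
  apply: ler_wpM2r; first exact: exprn_ge0.
  apply: le_trans H; apply: ler_wpM2r => //.
  rewrite -natr_sum ler_nat -sum1_card [X in (_ <= X)%N]big_mkcond /=.
  apply: leq_sum => i _; rewrite inE; case: eqP => [->|]; first by rewrite lexx.
  by case: ifP.
rewrite -!exprMn -expr2; apply: lerXn2r => //.
  by rewrite nnegrE mulr_ge0 ?exprn_ge0.
by rewrite nnegrE; case/andP: E01.
Qed.

(* Eigenvalues [n - k > 0] contribute [E^k / k!] and eigenvalues [2 - (n - k)
   <= 0] contribute [q^2 E^k / k!]; the constant comes from [7/4 + 11/64 <=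
   2]. *)
Lemma spectral_sum_le : \sum_i f i <= 1 + 2 * E.
Proof.
have /andP[E0 E1] := E01.
have pw i : f i <= \sum_(k < n) (th i == (n - k)%:R)%:R * q ^+ k +
     q ^+ 2 * \sum_(k < n.-1) (2 - th i == (n - k)%:R)%:R * q ^+ k.
  have [z thz zn] := th_int i; have [z' thz' z'n] := th'_int i.
  have zz' : z' = 2 - z.
    by apply/eqP; rewrite -(eqr_int R) -thz' thz rmorphB.
  have s0 N (t : R) : 0 <= \sum_(k < N) (t == (n - k)%:R)%:R * q ^+ k.
    by apply: sumr_ge0 => k _; rewrite mulr_ge0 ?exprn_ge0.
  have [z0|z0] := ltP 0 z.
    have kn : (n - `|z|%N < n)%N by lia.
    have zE : th i = (n - (n - `|z|))%:R.
      by rewrite thz subKn; [rewrite natr_absz gtr0_norm|lia].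
    apply: (@le_trans _ _ (q ^+ (n - `|z|%N))).
      by apply: f_le; [apply: ltnW|rewrite zE normr_nat].
    rewrite -[X in X <= _]addr0 lerD ?mulr_ge0 ?exprn_ge0 //.
    rewrite (bigD1 (Ordinal kn)) //= zE eqxx mul1r lerDl.
    by apply: sumr_ge0 => k _; rewrite mulr_ge0 ?exprn_ge0.
  (* As [z' = 2 - z >= 2], the level [k] is at most [n - 2], and the absolute value of [z] is
     [z' - 2 = n - (k + 2)]: this gains the factor [q ^ 2]. *)
  pose k := (n - `|z'|)%N.
  have kn : (k < n.-1)%N by rewrite /k; lia.
  have zE : 2 - th i = (n - k)%:R.
    by rewrite thz' /k subKn; [rewrite natr_absz gtr0_norm //; lia|lia].
  apply: (@le_trans _ _ (q ^+ k.+2)).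
    apply: f_le; first by lia.
    rewrite thz -intr_norm (_ : `|z| = (n - k.+2)%N) //; rewrite /k; lia.
  rewrite -[X in X <= _]add0r lerD // -addn2 addnC exprD.
  apply: ler_wpM2l; first exact: exprn_ge0.
  rewrite (bigD1 (Ordinal kn)) //= zE eqxx mul1r lerDl.
  by apply: sumr_ge0 => j _; rewrite mulr_ge0 ?exprn_ge0.
apply: le_trans (ler_sum _ (fun i _ => pw i)) _.
rewrite big_split /= -mulr_sumr exchange_big /= [X in q ^+ 2 * X]exchange_big /=.
have H1 : \sum_(k < n) \sum_i (th i == (n - k)%:R)%:R * q ^+ k <= 1 + 7 / 4 * E.
  apply: le_trans (sum_exp_fact_tail n E01); apply: ler_sum => k _.
  by apply: level_sum_le => //; apply: ltnW.
have H2 : \sum_(k < n.-1) \sum_i (2 - th i == (n - k)%:R)%:R * q ^+ k <= 11 / 4.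
  apply: le_trans (sum_exp_fact_le n.-1 E01); apply: ler_sum => k _.
  by apply: (@level_sum_le (fun i => 2 - th i)) => //; apply: ltnW; apply: leq_trans (leq_pred _).
have [n1|n2] := leqP n 1.
  have -> : n.-1 = 0%N by lia.
  by rewrite big_ord0 mulr0 addr0; lra.
(* For [n >= 2], [4 * q <= n ^ 2 * q <= E], and [E ^ 2 <= E]. *)
have q2 : q ^+ 2 <= E / 16.
  have n4 : 4 <= n%:R ^+ 2 :> R by rewrite -natrX ler_nat (@leq_sqr 2).
  have q4 : q <= E / 4.
    by rewrite ler_pdivlMr // mulrC; apply: le_trans nqE; apply: ler_wpM2r.
  have : q * q <= E / 4 * (E / 4) by apply: ler_pM.
  have : E * E <= E by rewrite ler_piMr.
  by rewrite expr2; lra.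
have H3 : q ^+ 2 * (\sum_(k < n.-1) \sum_i (2 - th i == (n - k)%:R)%:R * q ^+ k) <= E / 16 * (11 / 4).
  apply: ler_pM => //; first exact: exprn_ge0.
  by apply: sumr_ge0 => k _; apply: sumr_ge0 => i _; rewrite mulr_ge0 ?exprn_ge0.
by lra.
Qed.
End SumBound.

(** * The spectral sum of the star matrix *)

Section StarSum.
Variables (T : finType) (o : T) (N : nat).
Variables (e : 'I_N.+1 -> {perm T}) (r : {perm T} -> 'I_N.+1).
Hypotheses (eK : cancel e r) (rK : cancel r e).

Lemma star_diag_int (F : numFieldType) (P : 'M[F]_N.+1) (d : 'rV_N.+1) i :
  P \in unitmx -> P *m starmx o e F = diag_mx d *m P ->
  exists2 z : int, d 0 i = z%:~R & z <= #|T|.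
Proof.
move=> uP PB; apply: (starmx_eigen_int eK rK (o := o) (u := row i P)).
  apply/eqP => Pi; have /rowP/(_ i) : delta_mx 0 i = 0 :> 'rV[F]_N.+1.
    by rewrite -[LHS](mulmxK uP) -rowE Pi mul0mx.
  by rewrite !mxE !eqxx => /eqP; rewrite oner_eq0.
by rewrite -row_mul PB; apply/rowP => j; rewrite mul_diag_mx !mxE.
Qed.

Lemma star_sum_le (R : realFieldType) (P : 'M[R]_N.+1) (d : 'rV_N.+1) (g : R -> R) (q E : R) :
  P \in unitmx -> P *m starmx o e R = diag_mx d *m P ->
  0 <= q -> 0 <= E <= 1 -> #|T|%:R ^+ 2 * q <= E ->
  (forall x k, (k <= #|T|)%N -> `|x| = (#|T| - k)%:R -> g x <= q ^+ k) ->
  \sum_i g (d 0 i) <= 1 + 2 * E.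
Proof.
move=> uP PB q0 E01 qE gq; have [P' uP' P'B] := sign_twist eK uP PB.
apply: (@spectral_sum_le _ _ #|T| (fun i => d 0 i) _ q) => //.
- by apply/card_gt0P; exists o.
- by move=> i; apply: star_diag_int uP PB.
- by move=> i; have := star_diag_int i uP' P'B; rewrite mxE.
- by move=> k; apply: (card_eigen_ge eK rK k uP PB).
- move=> k; have := card_eigen_ge eK rK k uP' P'B; congr (_ * _ <= _)%N.
  by apply: eq_card => i; rewrite !inE mxE.
- by move=> i k; apply: gq.
Qed.
End StarSum.

Lemma sumRE (T : finType) (f : T -> R) : sumR f = \sum_x f x.
Proof. by rewrite /sumR -big_enum /= unlock. Qed.

(** * Exponential estimates and convergent series *)

Section StdlibExp.
Local Arguments exp x%_ring_scope.
Local Arguments ln x%_ring_scope.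
Implicit Types x y c t N : R.

Lemma exp_homo x y : x <= y -> exp x <= exp y.
Proof.
move=> /RleP xy; apply/RleP; case: (Rle_lt_or_eq_dec _ _ xy) => [lt|->].
  exact/Rlt_le/exp_increasing.
exact: Rle_refl.
Qed.

Lemma exp_gt0 x : 0 < exp x.
Proof. exact/RltP/exp_pos. Qed.

Lemma exp_ge1D x : 1 + x <= exp x.
Proof. exact/RleP/exp_ineq1_le. Qed.

(** The left side is [exp (2 * (ln N - t / N))]; this is where the lower bound on the time is
    spent. *)
Lemma sqr_mul_exp_le N c t : 0 < N -> N * (ln N + c) <= t ->
  N ^+ 2 * exp (- (2 * t / N)) <= exp (- c) ^+ 2.
Proof.
move=> N0 Nt.
have NE : N = exp (ln N) by rewrite exp_ln //; apply/RltP.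
rewrite {1}NE !expRX expRD; apply: exp_homo.
have : ln N + c <= t / N by rewrite ler_pdivlMr // mulrC.
by rewrite RplusE -mulrA; lra.
Qed.

(** The absolute value of [x / N] is [1 - k / N], at most [exp (- k / N)]. *)
Lemma sqr_pow_le_exp N x (t k : nat) : 0 < N -> k%:R <= N -> `|x| = N - k%:R ->
  ((x / N) ^+ t) ^+ 2 <= exp (- (2 * t%:R / N)) ^+ k.
Proof.
move=> N0 kN xE.
have a0 : 0 <= 1 - k%:R / N by rewrite subr_ge0 ler_pdivrMr // mul1r.
have aE : `|x / N| = 1 - k%:R / N.
  by rewrite normrM normfV (gtr0_norm N0) xE mulrBl divff // gt_eqF.
rewrite -exprM -[_ ^+ (t * 2)]ger0_norm; last by rewrite mulnC exprM exprn_ge0 ?sqr_ge0.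
rewrite normrX aE; apply: (@le_trans _ _ (exp (- (k%:R / N)) ^+ (t * 2))).
  by apply: lerXn2r; rewrite ?nnegrE //; [apply: ltW; apply: exp_gt0|apply: exp_ge1D].
rewrite [leLHS]expRX [leRHS]expRX -[- _ *+ (t * 2)]mulr_natr -[- _ *+ k]mulr_natr natrM.
by apply: exp_homo; lra.
Qed.

(** Since [x <= N - k], the factor [1 - x / N] is at least [k / N]. *)
Lemma sqr_exp_le N x t (k : nat) : 0 < N -> 0 <= t -> `|x| = N - k%:R ->
  exp (- (t * (1 - x / N))) ^+ 2 <= exp (- (2 * t / N)) ^+ k.
Proof.
move=> N0 t0 xE; rewrite [leLHS]expRX [leRHS]expRX; apply: exp_homo.
have xN : x <= N - k%:R by rewrite -xE ler_norm.
have kx : k%:R / N <= 1 - x / N.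
  by rewrite lerBrDr -mulrDl ler_pdivrMr // mul1r; lra.
rewrite -[_ *+ 2]mulr_natr -[- _ *+ k]mulr_natr !mulNr lerN2.
have := ler_wpM2l t0 kx; lra.
Qed.

Lemma infinite_sum_eq (a b : nat -> R) l : a =1 b -> infinite_sum a l -> infinite_sum b l.
Proof.
move=> ab al eps eps0; have [M HM] := al eps eps0; exists M => k kM.
rewrite (_ : sum_f_R0 b k = sum_f_R0 a k); first exact: HM.
by rewrite !sum_f_R0E; apply: eq_bigr => i _; rewrite ab.
Qed.

Lemma infinite_sumD (a b : nat -> R) l l' : infinite_sum a l -> infinite_sum b l' ->
  infinite_sum (fun k => a k + b k) (l + l').
Proof.
move=> al bl eps eps0; have [M HM] := CV_plus _ _ _ _ al bl eps eps0.
by exists M => k kM; rewrite sum_plus; apply: HM.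
Qed.

Lemma infinite_sumZ c (a : nat -> R) l : infinite_sum a l ->
  infinite_sum (fun k => c * a k) (c * l).
Proof.
have cc : Un_cv (fun=> c) c.
  by move=> eps eps0; exists 0%N => k _; rewrite RdistE subrr normr0.
move=> al eps eps0; have [M HM] := CV_mult _ _ _ _ cc al eps eps0.
exists M => k kM; rewrite (_ : sum_f_R0 _ k = c * sum_f_R0 a k); first exact: HM.
by rewrite !sum_f_R0E mulr_sumr.
Qed.

Lemma infinite_sum_sum (I : finType) (a : I -> nat -> R) (l : I -> R) :
  (forall i, infinite_sum (a i) (l i)) ->
  infinite_sum (fun k => \sum_i a i k) (\sum_i l i).
Proof.
move=> al; elim: (index_enum I) => [|i s IHs].
  rewrite big_nil; apply: (@infinite_sum_eq (fun k => 0 * exp 0)) => [k|].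
    by rewrite big_nil mul0r.
  move=> eps eps0; exists 0%N => k _.
  by rewrite sum_f_R0E big1 ?RdistE ?subrr ?normr0 // => j _; rewrite mul0r.
rewrite big_cons; apply: (infinite_sum_eq _ (infinite_sumD (al i) IHs)) => k.
by rewrite big_cons.
Qed.

(** Poisson generating function: it turns an eigenvalue [x] of one step into the eigenvalue of the
    continuous time law. *)
Lemma infinite_sum_poisson t x :
  infinite_sum (fun k => exp (- t) * (t ^+ k / k`!%:R) * x ^+ k)
    (exp (- (t * (1 - x)))).
Proof.
have -> : exp (- (t * (1 - x))) = exp (- t) * exp (t * x).
  by rewrite expRD; congr exp; rewrite RplusE; ring.
have := infinite_sumZ (exp (- t)) (proj2_sig (exist_exp (t * x))).
apply: infinite_sum_eq => k.
rewrite INRE factE RinvE RmultE RpowE exprMn; ring.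
Qed.

Lemma ln_nat_ge0 (k : nat) : 0 <= ln k.+1%:R.
Proof.
case: k => [|k]; first by rewrite (ln_1 : ln 1 = 0).
rewrite ltW // -[0](ln_1 : ln 1 = 0); apply/RltP/ln_increasing; first exact: Rlt_0_1.
by apply/RltP; rewrite (ltr_nat R 1).
Qed.

End StdlibExp.

(** * Transpose top with random and its distance to uniformity *)

Section TopWithRandom.
Local Arguments exp x%_ring_scope.
Local Arguments ln x%_ring_scope.
Variable m : nat.
Local Notation n := m.+1.

Lemma ttrE (s : Sn m) : ttr s = (\sum_k (s == tperm ord0 k)%:R) / n%:R.
Proof.
rewrite /ttr INRE; case: existsP => [[j /eqP ->]|H].
  rewrite (bigD1 j) //= eqxx big1 ?addr0 ?mul1r // => k /negbTE kj.
  rewrite (_ : (_ == _) = false) //; apply: contraFF kj => /eqP/permP/(_ ord0).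
  by rewrite !tpermL => ->.
rewrite big1 ?mul0r // => k _; case: eqP => // sk; case: H; exists k; exact/eqP.
Qed.

Lemma conv_ttr (p : Sn m -> R) s :
  conv p (@ttr m) s = (\sum_k p (s * tperm ord0 k)%g) / n%:R.
Proof.
rewrite /conv sumRE.
rewrite (eq_bigr (fun y => \sum_k p y * (s * tperm ord0 k == y)%g%:R / n%:R)); last first.
  move=> y _; rewrite ttrE RmultE mulrA mulr_sumr mulr_suml; apply: eq_bigr => k _.
  congr (_ * (nat_of_bool _)%:R / _); apply/eqP/eqP => [H|<-].
    by rewrite -[s in LHS](mulKVg y) H -mulgA tperm2 mulg1.
  by rewrite invMg mulgKV tpermV.
rewrite exchange_big mulr_suml /=; apply: eq_bigr => k _.
by rewrite -mulr_suml sum_indicator.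
Qed.

Variables (N : nat) (e : 'I_N.+1 -> Sn m) (r : Sn m -> 'I_N.+1).
Hypotheses (eK : cancel e r) (rK : cancel r e).
Variables (P : 'M[R]_N.+1) (d : 'rV[R]_N.+1).
Hypotheses (uP : P \in unitmx) (PB : P *m starmx ord0 e R = diag_mx d *m P).

Lemma convpow_starmx t s :
  convpow (@ttr m) t s = (starmx ord0 e R ^+ t) (r 1%g) (r s) / n%:R ^+ t.
Proof.
elim: t s => [|t IHt] s.
  rewrite expr0 divr1 mxE (inj_eq (can_inj rK)) eq_sym /= /delta_e.
  by case: eqP.
rewrite [LHS]conv_ttr [_%:R ^+ t.+1]exprSr invfM mulrA; congr (_ / _).
rewrite exprSr.
have -> : (starmx ord0 e R ^+ t * starmx ord0 e R) (r 1%g) (r s) =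
  (row (r 1%g) (starmx ord0 e R ^+ t) *m starmx ord0 e R) 0 (r s).
  by rewrite -row_mul [RHS]mxE.
rewrite (mul_starmx _ eK rK) mulr_suml; apply: eq_bigr => k _.
by rewrite [LHS]IHt [in RHS]mxE.
Qed.

Lemma convpow_spectral t s :
  convpow (@ttr m) t s =
  \sum_k invmx P (r 1%g) k * P k (r s) * (d 0 k / n%:R) ^+ t.
Proof.
rewrite convpow_starmx (spectral_fun_exp _ uP PB) spectral_funE mulr_suml.
by apply: eq_bigr => k _; rewrite expr_div_n mulrA.
Qed.

(** The condition at [n] gives total mass 1, so centering at the uniform measure subtracts exactly 1
    from the normalized sum of squares. *)
Lemma dist2_spectral_fun (g : R -> R) : g n%:R = 1 ->
  dist2 (fun s => spectral_fun P d g (r 1%g) (r s)) =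
  sqrt (\sum_i g (d 0 i) ^+ 2 - 1).
Proof.
move=> g1; congr sqrt; rewrite sumRE INRE RmultE.
have cG : #|{: Sn m}| = N.+1.
  by rewrite -(bij_eq_card (Bijective eK rK)) card_ord.
rewrite cG -(sum_spectral_fun_sq eK rK uP PB).
have sG : \sum_s spectral_fun P d g (r 1%g) (r s) = 1.
  by apply: (sum_spectral_fun eK rK uP PB); rewrite card_ord.
have := sum_sq_centered _ sG; rewrite cG => /(_ isT) sq; apply: etrans sq.
congr (_ * _); apply: eq_bigr => s _.
by rewrite RpowE RabsE real_normK ?num_real // /unif cG INRE RinvE RminusE.
Qed.

(** Common to both clocks: [g x] is [(x / n) ^ t] in discrete time and [exp (- t * (1 - x / n))] in
    continuous time. *)
Lemma dist2_spectral_fun_le (g : R -> R) (c t : R) : g n%:R = 1 ->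
  0 <= c -> n%:R * (ln n%:R + c) <= t ->
  (forall x k, (k <= n)%N -> `|x| = (n - k)%:R -> g x ^+ 2 <= exp (- (2 * t / n%:R)) ^+ k) ->
  dist2 (fun s => spectral_fun P d g (r 1%g) (r s)) <= Num.sqrt 2 * exp (- c).
Proof.
move=> g1 c0 ct gb.
rewrite dist2_spectral_fun //.
have e0 x : 0 < exp x by apply/RltP; apply: exp_pos.
have -> : Num.sqrt 2 * exp (- c) = Num.sqrt (2 * exp (- c) ^+ 2).
  by rewrite sqrtrM // sqrtr_sqr ger0_norm //; apply: ltW.
rewrite RsqrtE; apply: ler_wsqrtr; rewrite lerBlDl.
have n0 : (0 : R) < n%:R by rewrite ltr0n.
have E1 : exp (- c) <= 1.
  by have := exp_homo (_ : - c <= 0); rewrite exp_0; apply; rewrite oppr_le0.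
apply: (star_sum_le eK rK (g := fun x => g x ^+ 2) (q := exp (- (2 * t / n%:R))) uP PB).
- exact: ltW.
- by rewrite exprn_ge0 ?exprn_ile1 // ltW.
- by rewrite card_ord; apply: sqr_mul_exp_le.
- by rewrite card_ord.
Qed.

Lemma dist2_convpow_le (c : R) (t : nat) : 0 <= c -> n%:R * (ln n%:R + c) <= t%:R ->
  dist2 (convpow (@ttr m) t) <= Num.sqrt 2 * exp (- c).
Proof.
move=> c0 ct; have n0 : (0 : R) < n%:R by rewrite ltr0n.
pose g (x : R) := (x / n%:R) ^+ t.
have -> : dist2 (convpow (@ttr m) t) = dist2 (fun s => spectral_fun P d g (r 1%g) (r s)).
  congr sqrt; congr (_ * _); rewrite !sumRE; apply: eq_bigr => s _.
  by rewrite convpow_spectral spectral_funE.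
apply: (dist2_spectral_fun_le (t := t%:R)) => //.
  by rewrite /g divff ?expr1n // gt_eqF.
move=> x k kn xE; apply: sqr_pow_le_exp => //; first by rewrite ler_nat.
by rewrite xE natrB.
Qed.

Lemma dist2_ctlaw_le (c t : R) (h : Sn m -> R) : 0 <= c -> n%:R * (ln n%:R + c) <= t ->
  is_ctlaw (@ttr m) t h -> dist2 h <= Num.sqrt 2 * exp (- c).
Proof.
move=> c0 ct hh; have n0 : (0 : R) < n%:R by rewrite ltr0n.
pose g (x : R) := exp (- (t * (1 - x / n%:R))).
have -> : dist2 h = dist2 (fun s => spectral_fun P d g (r 1%g) (r s)).
  congr sqrt; congr (_ * _); rewrite !sumRE; apply: eq_bigr => s _.
  rewrite spectral_funE.
  suff -> : h s = \sum_k invmx P (r 1%g) k * P k (r s) * g (d 0 k) by [].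
  (* The Poisson series is summed eigenvalue by eigenvalue, the sum over the spectrum being finite,
     and limits are unique. *)
  apply: (uniqueness_sum _ _ _ (hh s)).
  have := infinite_sum_sum (fun k => infinite_sumZ (invmx P (r 1%g) k * P k (r s))
    (infinite_sum_poisson t (d 0 k / n%:R))).
  apply: infinite_sum_eq => k; rewrite convpow_spectral RpowE INRE factE RmultE mulr_sumr.
  by apply: eq_bigr => i _; rewrite mulrCA.
apply: (dist2_spectral_fun_le (t := t)) => //.
  by rewrite /g divff ?gt_eqF // subrr mulr0 oppr0 exp_0.
move=> x k kn xE; apply: sqr_exp_le => //; last by rewrite xE natrB.
(* Nonnegativity of [t] follows from its lower bound, as [ln n >= 0]. *)
apply: le_trans ct; apply: mulr_ge0 => //; apply: addr_ge0 => //.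
exact: ln_nat_ge0.
Qed.
End TopWithRandom.

(* The two numerals differ: [IZR 2] on the left, [2%:R] on the right. *)
Lemma sqrt2E : sqrt 2 = Num.sqrt 2.
Proof. exact: RsqrtE. Qed.

Local Close Scope ring_scope.
(* [all_algebra] rebinds the key [R] to [ring_scope]. *)
Delimit Scope R_scope with R.

(* n = m.+1 ranges over all n >= 1 *)
Theorem theorem3p1 (m : nat) (c : R) (hc : (0 <= c)%R) :
  (forall t : nat,
     (INR m.+1 * (ln (INR m.+1) + c) <= INR t)%R ->
     (dist2 (convpow (@ttr m) t) <= sqrt 2 * exp (- c))%R) /\
  (forall (t : R) (h : Sn m -> R),
     (INR m.+1 * (ln (INR m.+1) + c) <= t)%R ->
     is_ctlaw (@ttr m) t h ->
     (dist2 h <= sqrt 2 * exp (- c))%R).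
Proof.
(* The successor form of the dimension gives square matrices their ring structure, needed for powers
   of B. *)
have cN : #|{: Sn m}|.-1.+1 = #|{: Sn m}| by rewrite prednK // (cardD1 1%g).
pose e i : Sn m := enum_val (cast_ord cN i).
pose r (s : Sn m) := cast_ord (esym cN) (enum_rank s).
have eK : cancel e r by move=> i; rewrite /e /r enum_valK cast_ordK.
have rK : cancel r e by move=> s; rewrite /e /r cast_ordKV enum_rankK.
have [P [d [uP PB]]] := symmetric_diagonalizable (starmx_sym ord0 e R).
have /RleP c0 := hc.
rewrite sqrt2E.
split=> [t|t h] ct; [|move=> hh]; apply/RleP.
  apply: (dist2_convpow_le eK rK uP PB c0).
  by have /RleP := ct; rewrite !INRE.
apply: (dist2_ctlaw_le eK rK uP PB c0 _ hh).
by have /RleP := ct; rewrite INRE.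
Qed.
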